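(* For every integer $N\ge 286$ and every admissible set $A\subseteq\{1,\dots,N\}$, $$\sum_{a\in A}\frac1a\le\frac12\log N+(\log\log N+2)^2 .$$ Consequently, every admissible set $A$ of positive integers has upper logarithmic density at most $1/2$, i.e. $\limsup_{X\to\infty}\frac{1}{\log X}\sum_{a\in A,\,a\le X}\frac1a\le\frac12$, and natural density at most $1/2$ whenever its natural density $\lim_{X\to\infty}\frac{|A\cap[1,X]|}{X}$ exists.
   Context: A set $A$ of positive integers is called admissible if for all finite subsets $S,T\subseteq A$ with $\prod_{s\in S}s=\prod_{t\in T}t$ one has $|S|=|T|$ (the empty product is $1$, so in particular $1\notin A$). Here $\log$ is the natural logarithm. *)

(* Defs.v *)
From mathcomp Require Import all_boot all_order all_algebra finmap.
From mathcomp Require Import all_classical all_reals all_analysis.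
Set Implicit Arguments.
Unset Strict Implicit.
Unset Printing Implicit Defensive.
Import Order.TTheory GRing.Theory Num.Theory.
Import numFieldNormedType.Exports.
Local Open Scope classical_set_scope.
Local Open Scope ring_scope.

(* The products are taken in [nat]; taking [S] empty and [T] = {1} shows that
   an admissible set does not contain 1. *)
Definition admissible (A : set nat) : Prop :=
  A `<=` [set a | (0 < a)%N] /\
  forall S T : {fset nat}, [set` S] `<=` A -> [set` T] `<=` A ->
    (\prod_(s <- S) s = \prod_(t <- T) t)%N -> #|` S| = #|` T|.

(* The sets [A `&` [set a | a%:R <= X]] are finite, so the junk values that
   [\sum_(_ \in _)] and [fset_set] take on infinite sets do not arise. *)
Definition log_average (R : realType) (A : set nat) (X : R) : R :=
  (ln X)^-1 * \sum_(a \in A `&` [set a | (a%:R : R) <= X]) (a%:R : R)^-1.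

Definition upper_log_density (R : realType) (A : set nat) : \bar R :=
  limf_esup (fun X : R => (log_average A X)%:E) +oo.

Definition has_natural_density (R : realType) (A : set nat) (d : R) : Prop :=
  #|` fset_set (A `&` [set a | 1 <= (a%:R : R) <= X])|%:R / X @[X --> +oo] --> d.

(* Main.v *)
(* Call a prime p good if few a satisfy a, pa \in A (fewer than about 2 log_2 N of
   them), and bad otherwise. An element n of A cannot be a product p_1...p_k of
   bad primes: choosing suitable a_i with a_i, p_i a_i \in A, the identity
   n * a_1...a_k = (p_1 a_1)...(p_k a_k) would violate admissibility.
   Deleting from A every pa with p good and a, pa \in A costs at most
   sum_p 1/p * sum_(a <= 2 log_2 N) 1/a, a product of two factors
   log log N + O(1). In the remaining set no two elements differ by a good prime
   factor, and matching d with pd inside the divisors of n shows that it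
   contains at most half of the divisors of every n; summing over n <= N gives
   the main term log N / 2. *)
Require Import Defs.
From mathcomp Require Import all_boot all_order all_algebra finmap zify ring lra.
From mathcomp Require Import all_classical all_reals all_analysis.
Import Order.TTheory GRing.Theory Num.Theory.
Import numFieldNormedType.Exports.
Local Open Scope classical_set_scope.
Local Open Scope ring_scope.

(** * Admissible sets and divisors *)

Section NatCombinatorics.
Local Open Scope nat_scope.

(** Primes are listed with multiplicity and each is at least 2, which bounds the length; for
    [n <= N] it is at most [trunc_log 2 N]. *)
Lemma prime_factorization (n : nat) : 0 < n ->
  exists2 ps : seq nat, all (fun p => prime p && (p %| n)) ps &
    \prod_(p <- ps) p = n /\ 2 ^ size ps <= n.
Proof.
elim/ltn_ind: n => n IH n0; case: (ltnP 1 n) => [n1|n1]; last first.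
  by exists [::] => //; rewrite big_nil; split=> //; lia.
have pp := pdiv_prime n1; have pn := pdiv_dvd n.
have qn : n %/ pdiv n < n by rewrite ltn_Pdiv // prime_gt1.
have q0 : 0 < n %/ pdiv n by rewrite divn_gt0 ?pdiv_gt0 // pdiv_leq.
have [ps psP [psE sz]] := IH _ qn q0.
exists (pdiv n :: ps) => /=.
  rewrite pp pn /=; apply: sub_all psP => p /andP[-> /= pd].
  by apply: dvdn_trans pd _; apply/dvdnP; exists (pdiv n); rewrite mulnC divnK.
rewrite big_cons psE mulnC divnK //; split=> //.
rewrite expnS -[leqRHS](divnK pn) mulnC leq_mul //; exact: prime_gt1.
Qed.

Section Greedy.
Variable A : pred nat.
Hypothesis A_gt0 : forall n, A n -> 0 < n.
Hypothesis A_adm : forall s t : seq nat, uniq s -> uniq t -> all A s -> all A t ->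
  \prod_(x <- s) x = \prod_(x <- t) x -> size s = size t.

(* The earlier choices rule out fewer than [2 * size ps] values of [a]. Elements
   common to [s] and [t] are harmless. *)
Lemma greedy_choice (N n : nat) (ps : seq nat) :
  (forall p, p \in ps -> 0 < p /\
     2 * size ps <= count (fun a => A a && A (p * a)) (iota 1 N)) ->
  exists s t : seq nat, [/\ size s = size ps /\ size t = size ps,
    uniq (n :: s), uniq t, all A s /\ all A t &
    \prod_(x <- t) x = (\prod_(p <- ps) p) * \prod_(x <- s) x].
Proof.
elim: ps => [|p ps IH] H.
  by exists [::], [::]; rewrite !big_nil; split.
have [q qps|s [t [[ss st] us ut [As At] E]]] := IH.
  have [|q0 qc] := H q; first by rewrite inE qps orbT.
  by split=> //; apply: leq_trans qc; rewrite /= leq_mul2l leqnSn.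
have [p0 pc] := H p (mem_head _ _).
pose Q := [seq a <- iota 1 N | A a && A (p * a)].
(* Avoiding [F] keeps [a] out of [n :: s] and [p * a] out of [t]. Its size is [2 * size ps + 1], one
   less than the number of candidates guaranteed by the hypothesis on [p]. *)
pose F := (n :: s) ++ [seq x %/ p | x <- t].
have [a aQ aF] : exists2 a, a \in Q & a \notin F.
  apply/hasP; rewrite has_predC; apply/negP=> /allP QF.
  have uQ : uniq Q by rewrite filter_uniq // iota_uniq.
  have := uniq_leq_size uQ QF.
  rewrite size_cat size_map /= size_filter ss st => le.
  by have := leq_trans pc le; rewrite /= ; lia.
move: aQ; rewrite mem_filter => /andP[/andP[Aa Apa] _].
move: aF; rewrite mem_cat negb_or inE negb_or => /andP[/andP[an as_] at_].
exists (a :: s), (p * a :: t); split => /=.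
- by rewrite ss st.
- move: us => /= /andP[ns us]; rewrite inE negb_or ns us as_ eq_sym an //.
- rewrite ut andbT; apply: contra at_ => pat; apply/mapP.
  by exists (p * a); rewrite ?mulKn.
- by rewrite Aa Apa.
- by rewrite !big_cons E; lia.
Qed.

Lemma exists_good_prime (N n : nat) : n <= N -> A n ->
  exists p, [/\ prime p, p %| n &
    count (fun a => A a && A (p * a)) (iota 1 N) < 2 * trunc_log 2 N].
Proof.
move=> nN An; have n0 := A_gt0 _ An.
have [ps psP [psE sz]] := prime_factorization _ n0.
pose bad p := 2 * trunc_log 2 N <= count (fun a => A a && A (p * a)) (iota 1 N).
have [allbad|/allPn[p pps]] := boolP (all bad ps); last first.
  rewrite /bad -ltnNge => pg; exists p; split=> //;
  by move/allP: psP => /(_ _ pps)/andP[].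
have szN : size ps <= trunc_log 2 N by apply: trunc_log_max => //; exact: leq_trans nN.
have [p pps|s [t [[ss st] us ut [As At] E]]] := greedy_choice N n ps.
  move/allP: psP => /(_ _ pps)/andP[/prime_gt0 p0 _]; split=> //.
  by move/allP: allbad => /(_ _ pps); apply: leq_trans; rewrite leq_mul2l szN.
(* Equal products, but [n :: s] is one longer than [t]. For [n = 1] the list [ps] is empty, and this
   compares {1} with the empty set. *)
have := A_adm (n :: s) t us ut; rewrite /= An As At big_cons E psE.
by move=> /(_ isT isT erefl); rewrite ss st; lia.
Qed.

End Greedy.

(** * Sets containing at most half of the divisors of every integer *)

(** Layers are paired from the top; for odd [k] the layer 0 remains and is covered by the first
    hypothesis. Carrying two consecutive values of [k] turns the step by two into an ordinary
    induction. *)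
Lemma sum_alternating_layers (X : nat -> nat) (t : nat) :
  2 * X 0 <= t -> (forall i, X i + X i.+1 <= t) ->
  forall k, 2 * \sum_(i < k) X i <= k * t.
Proof.
move=> X0 XS k.
suff : 2 * \sum_(i < k) X i <= k * t /\ 2 * \sum_(i < k.+1) X i <= k.+1 * t by case.
elim: k => [|k [IH1 IH2]]; first by rewrite big_ord_recr !big_ord0 /= mul1n add0n; split.
split=> //; move: IH1; rewrite !big_ord_recr /= !mulSn; have := XS k; lia.
Qed.

(** The layers are disjoint because [logn p] recovers [i] from [p ^ i * d]; conversely a divisor
    splits into its [p]-part and a cofactor prime to [p], which divides [m] by Gauss. *)
Lemma divisors_prime_power (p e m : nat) : prime p -> 0 < m -> ~~ (p %| m) ->
  perm_eq (divisors (p ^ e * m))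
          (flatten [seq [seq p ^ i * d | d <- divisors m] | i <- iota 0 e.+1]).
Proof.
move=> pp m0 pm; have p0 := prime_gt0 pp.
have cop i d : d %| m -> coprime (p ^ i) d.
  move=> dm; rewrite coprimeXl // prime_coprime //.
  by apply: contra pm => /dvdn_trans; apply.
have lg i d : d %| m -> logn p (p ^ i * d) = i.
  move=> dm; have d0 := dvdn_gt0 m0 dm.
  rewrite lognM ?expn_gt0 ?p0 // pfactorK // lognE pp d0 /=.
  by rewrite ifN ?addn0 //; apply: contra pm => /dvdn_trans; apply.
apply: uniq_perm; first exact: divisors_uniq.
  apply: allpairs_uniq_dep; first exact: iota_uniq.
    by move=> i _; exact: divisors_uniq.
  move=> [i d] [j c] /allpairsPdep[x [y [_ yd [-> ->]]]] /allpairsPdep[z [w [_ wd [-> ->]]]] /= E.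
  move: yd wd; rewrite -!dvdn_divisors // => yd wd.
  have xz : x = z by rewrite -(lg x y yd) E lg.
  by move/eqP: E; rewrite xz eqn_pmul2l ?expn_gt0 ?p0 // => /eqP ->.
move=> d; rewrite -dvdn_divisors ?muln_gt0 ?expn_gt0 ?p0 //.
apply/idP/allpairsPdep => [dd|[i [c []]]]; last first.
  rewrite mem_iota /= -dvdn_divisors // => ie cm ->.
  by apply: dvdn_mul => //; rewrite dvdn_exp2l //; lia.
have d0 : 0 < d by apply: dvdn_gt0 dd; rewrite muln_gt0 expn_gt0 p0.
have [c pc dE] := pfactor_coprime pp d0.
exists (logn p d), c; split; last by rewrite mulnC.
  by rewrite mem_iota /= add0n ltnS -(lg e m) // dvdn_leq_log // muln_gt0 expn_gt0 p0.
rewrite -dvdn_divisors //.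
have : c %| p ^ e * m by apply: dvdn_trans dd; apply/dvdnP; exists (p ^ logn p d); rewrite mulnC.
by rewrite Gauss_dvdr // coprimeXr // coprime_sym.
Qed.

(* For a good prime [p] and [n = p ^ e * m], the divisors of [n] split into the
   layers [p ^ i * d], [d %| m], and multiplication by [p] matches consecutive
   layers. If [e] is even, the unmatched layer [i = 0] is handled by induction,
   down to the divisors without good prime factors, which avoid [B]. *)
Lemma count_divisors_half (B G : pred nat) :
  (forall p, G p -> prime p) ->
  (forall n, B n -> exists2 p, G p & p %| n) ->
  (forall n p, G p -> B n -> B (p * n) -> False) ->
  forall n, 0 < n -> 2 * \sum_(d <- divisors n) B d <= size (divisors n).
Proof.
move=> Gp BG indep n; elim/ltn_ind: n => n IH n0.
have [/hasP[p pn Gpp]|nG] := boolP (has G (primes n)); last first.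
  rewrite big_seq big1 // => d; rewrite -dvdn_divisors // => dn.
  apply/eqP; rewrite eqb0; apply: contra nG => /BG[p Gpp pd].
  by apply/hasP; exists p => //; rewrite mem_primes Gp // n0 (dvdn_trans pd).
have pp := Gp _ Gpp; move: pn; rewrite mem_primes => /and3P[_ _ pn].
have [m pm nE] := pfactor_coprime pp n0; set e := logn p n in nE.
have e0 : 0 < e by rewrite logn_gt0 mem_primes pp n0.
have m0 : 0 < m by move: n0; rewrite nE muln_gt0 => /andP[].
have mn : m < n by rewrite nE -[ltnLHS]muln1 ltn_pmul2l // -(expn0 p) ltn_exp2l ?prime_gt1.
have pm' : ~~ (p %| m) by rewrite -prime_coprime.
have P : perm_eq (divisors n)
   (flatten [seq [seq p ^ i * d | d <- divisors m] | i <- iota 0 e.+1]).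
  by rewrite {1}nE mulnC divisors_prime_power.
rewrite (perm_size P) (perm_big _ P) size_allpairs_dep big_allpairs_dep.
have -> : sumn [seq size (divisors m) | _ <- iota 0 e.+1] = e.+1 * size (divisors m).
  by rewrite sumnE big_map big_const_seq count_predT size_iota iter_addn_0 mulnC.
rewrite -{1}[e.+1]subn0 -/(index_iota 0 e.+1) big_mkord.
apply: (sum_alternating_layers (fun i => \sum_(d <- divisors m) B (p ^ i * d))).
  rewrite (eq_bigr (fun d => B d : nat)); first exact: IH.
  by move=> d _; rewrite mul1n.
move=> i; rewrite -big_split /= -sum1_size leq_sum // => d _.
rewrite expnS -mulnA; have := indep (p ^ i * d) p Gpp.
by case: (B _) => //; case: (B _) => //= /(_ isT isT).
Qed.

(** [N %/ d] counts the multiples of [d] up to [N]; the two sums are then exchanged. *)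
Lemma sum_floor_divisors (B : pred nat) (N : nat) :
  \sum_(1 <= d < N.+1 | B d) N %/ d =
  \sum_(1 <= n < N.+1) \sum_(d <- divisors n) B d.
Proof.
under eq_bigr do rewrite divn_count_dvd.
rewrite exchange_big /= big_nat [RHS]big_nat; apply: eq_bigr => n /andP[n0 nN].
transitivity (\sum_(d <- index_iota 1 N.+1 | (d %| n) && B d) 1).
  by rewrite big_mkcond [RHS]big_mkcond; apply: eq_bigr => i _ /=; case: (B i); case: (i %| n).
rewrite [RHS](eq_bigr (fun d => if B d then 1 else 0)); last by move=> i _; case: (B i).
rewrite -[RHS]big_mkcond /= -big_filter -[RHS]big_filter; apply: perm_big.
apply: uniq_perm; rewrite ?filter_uniq ?iota_uniq ?divisors_uniq // => d.
rewrite !mem_filter mem_index_iota -dvdn_divisors //.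
rewrite [in RHS]andbC -andbA; case dn: (d %| n) => //=.
case: (B d); rewrite ?andbF //=.
by rewrite (dvdn_gt0 n0 dn) ltnS (leq_trans (dvdn_leq n0 dn)).
Qed.

Lemma sum_floor_half (B G : pred nat) (N : nat) :
  (forall p, G p -> prime p) ->
  (forall n, B n -> exists2 p, G p & p %| n) ->
  (forall n p, G p -> B n -> B (p * n) -> False) ->
  2 * \sum_(1 <= d < N.+1 | B d) N %/ d <= \sum_(1 <= d < N.+1) N %/ d.
Proof.
move=> Gp BG indep; rewrite sum_floor_divisors (sum_floor_divisors predT).
rewrite big_distrr /= big_nat [leqRHS]big_nat leq_sum // => n /andP[n0 _].
by rewrite (leq_trans (count_divisors_half B G _ _ _ n n0)) // sum1_size.
Qed.

(** * Upper bounds of Chebyshev and Mertens *)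

(** Each selected prime is at most its own factor [p ^ logn p x] in the factorization of [x]. The
    range is widened to [maxn x n] so that it can be cut at [n]. *)
Lemma prod_prime_divisors_leq (P : pred nat) (n x : nat) : 0 < x ->
  (forall p, p < n -> P p -> prime p && (p %| x)) ->
  \prod_(0 <= p < n | P p) p <= x.
Proof.
move=> x0 HP; have H : forall p, 0 < p ^ logn p x.
  by move=> [|p]; rewrite ?expn_gt0 //= /logn.
rewrite -[leqRHS](@partnT x) // (@widen_partn (maxn x n)) ?leq_maxl //.
rewrite [leqRHS](@big_cat_nat _ _ _ n) //=; last by rewrite ltnW // ltnS leq_maxr.
apply: (@leq_trans (\prod_(0 <= p < n) p ^ logn p x)); last first.
  by rewrite leq_pmulr // prodn_gt0.
rewrite big_mkcond big_nat [leqRHS]big_nat leq_prod // => p /andP[_ pn].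
case: ifP => // Pp; have /andP[pp px] := HP _ pn Pp.
by rewrite -[leqLHS]expn1 leq_exp2l ?prime_gt1 // logn_gt0 mem_primes pp x0 px.
Qed.

(** A weak form of Legendre's formula: [p ^ (n %/ p)] collects one factor [p] from each multiple
    [k <= n] of [p]. After exchanging the products, each [k] receives the product of its distinct
    primes, at most [k]. *)
Lemma prod_primes_pow_leq_fact (n : nat) :
  \prod_(0 <= p < n.+1 | prime p) p ^ (n %/ p) <= n`!.
Proof.
rewrite fact_prod.
under eq_bigr do rewrite divn_count_dvd expn_sum.
rewrite exchange_big /= big_nat [leqRHS]big_nat leq_prod // => k /andP[k0 kn].
rewrite (eq_bigr (fun p => if p %| k then p else 1)); last first.
  by move=> p _; case: (p %| k).
rewrite -big_mkcondr; apply: prod_prime_divisors_leq => // p _.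
Qed.

Lemma prime_dvd_fact (p n : nat) : prime p -> p %| n`! -> p <= n.
Proof.
move=> pp; elim: n => [|n IH]; first by rewrite dvdn1 => /eqP pE; rewrite pE in pp.
rewrite factS Euclid_dvdM // => /orP[/dvdn_leq->//|/IH]; exact: leqW.
Qed.

(** Two equal middle coefficients occur in the expansion of [(1 + 1) ^ (2m + 1)]. *)
Lemma bin_odd_middle_leq (m : nat) : 'C(m.*2.+1, m) <= 4 ^ m.
Proof.
have : 'C(m.*2.+1, m) + 'C(m.*2.+1, m.+1) <= 2 ^ m.*2.+1.
  rewrite -[2]/(1 + 1) expnDn.
  have mlt : m < m.*2.+2 by lia.
  have m1lt : m.+1 < m.*2.+2 by lia.
  rewrite (bigD1 (Ordinal mlt)) //= (bigD1 (Ordinal m1lt)) /=; last first.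
    by apply/negP => /eqP/(congr1 val) /=; lia.
  by rewrite !exp1n !muln1 addnA leq_addr.
have -> : 'C(m.*2.+1, m.+1) = 'C(m.*2.+1, m).
  by rewrite -bin_sub; [congr 'C(_, _); lia|lia].
by rewrite expnS -mul2n expnM -[2 ^ 2]/4; lia.
Qed.

(** Erdős's argument: an even [n > 2] is not prime, and for [n = 2m + 1] the primes in
    [[m + 2, 2m + 1]] divide ['C(2m + 1, m)]. The exponent [n.-1] makes the halves fit:
    [m + m = n - 1]. *)
Lemma primorial_leq (n : nat) : \prod_(0 <= p < n.+1 | prime p) p <= 4 ^ n.-1.
Proof.
elim/ltn_ind: n => n IH.
have [n2|n2] := leqP n 2.
  by case: n n2 {IH} => [|[|[|//]]] _; rewrite unlock.
have [on|en] := boolP (odd n); last first.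
  rewrite big_mkcond big_nat_recr //= -big_mkcond /= ifN ?muln1.
    have := IH n.-1; rewrite prednK; last by lia.
    by move=> /(_ _)/leq_trans; apply; rewrite ?leq_exp2l; lia.
  by apply/negP => /even_prime[]; lia.
pose m := n./2; have nE : n = m.*2.+1 by rewrite -[LHS]odd_double_half on.
have m0 : 0 < m by lia.
rewrite (@big_cat_nat _ _ _ m.+2) //=; last by lia.
have -> : 4 ^ n.-1 = 4 ^ m * 4 ^ m by rewrite -expnD; congr (_ ^ _); lia.
apply: leq_mul; first by apply: (IH m.+1); lia.
apply: leq_trans (bin_odd_middle_leq m).
rewrite (@big_nat_widenl _ _ _ _ 0) //; apply: prod_prime_divisors_leq.
  by rewrite bin_gt0; lia.
move=> p pn /andP[pp mp]; rewrite pp /=.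
have : p %| (m.*2.+1)`! by rewrite dvdn_fact //; lia.
rewrite -(@bin_fact _ m); last by lia.
rewrite !Euclid_dvdM // => /orP[//|/orP[]] /(prime_dvd_fact _ _ pp); lia.
Qed.

End NatCombinatorics.

Section Mertens.
Variable R : realType.
Implicit Types (x y : R) (n N : nat).

(** * Elementary and numerical bounds for the logarithm *)

Lemma ln_leB1 x : 0 < x -> ln x <= x - 1.
Proof. by move=> x0; have := @le_ln1Dx R (x - 1); rewrite subrKC; apply; lra. Qed.

Lemma ln_ge1BV x : 0 < x -> 1 - x^-1 <= ln x.
Proof.
move=> x0; have := ln_leB1 x^-1; rewrite invr_gt0 => /(_ x0).
by rewrite lnV ?posrE //; lra.
Qed.

Lemma expR_ge_pow x n : 0 <= 1 + x / n.+1%:R -> (1 + x / n.+1%:R) ^+ n.+1 <= expR x.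
Proof.
move=> h; have -> : expR x = expR (x / n.+1%:R) ^+ n.+1.
  by rewrite -expRM_natl; congr expR; field; rewrite addrC natr1 pnatr_eq0.
by rewrite lerXn2r ?nnegrE ?expR_ge0 // expR_ge1Dx.
Qed.

Lemma pow_double_ge (a b x : R) n : 0 <= a -> a <= x ^+ n -> b <= a * a -> b <= x ^+ (n + n).
Proof. by move=> a0 h h2; rewrite exprD; apply: le_trans h2 _; rewrite ler_pM. Qed.

Lemma ln2_ge : 2 / 3 <= ln 2 :> R.
Proof.
have -> : 2 / 3 = - ln (expR (- (2 / 3))) :> R by rewrite expRK opprK.
rewrite -lnV ?posrE ?expR_gt0 // ler_ln ?posrE ?invr_gt0 ?expR_gt0 //.
rewrite invf_ple ?posrE ?expR_gt0 //.
(* It remains to show [(23 / 24) ^ 16 >= 1 / 2]. This is done by repeated squaring, rounding down to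
   fractions with small denominators. *)
apply: le_trans (expR_ge_pow (- (2 / 3)) 15 _); last by lra.
set x : R := 1 + _; have h1 : 23 / 24 <= x ^+ 1 by rewrite /x; lra.
have h2 : 45 / 49 <= x ^+ 2 by apply: (pow_double_ge _ _ _ 1 _ h1); lra.
have h4 : 59 / 70 <= x ^+ 4 by apply: (pow_double_ge _ _ _ 2 _ h2); lra.
have h8 : 17 / 24 <= x ^+ 8 by apply: (pow_double_ge _ _ _ 4 _ h4); lra.
by apply: (pow_double_ge _ _ _ 8 _ h8); lra.
Qed.

Lemma ln3_le : ln 3 <= 5 / 4 :> R.
Proof.
rewrite -[leRHS]expRK ler_ln ?posrE ?expR_gt0 //.
(* With exponent 5 the base is [1 + (5 / 4) / 5 = 5 / 4], and [(5 / 4) ^ 5 > 3]. *)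
apply: le_trans (expR_ge_pow (5 / 4) 4 _); last by lra.
have -> : 1 + 5 / 4 / 5 = 5 / 4 :> R by lra.
by rewrite !exprS expr0; lra.
Qed.

Lemma ln_nat_ge0 n : 0 <= ln n%:R :> R.
Proof. by case: n => [|n]; [rewrite ln0|rewrite ln_ge0 // ler1n]. Qed.

Lemma ln_nat_le (m n : nat) : (0 < m)%N -> (m <= n)%N -> ln m%:R <= ln n%:R :> R.
Proof. by move=> m0 mn; rewrite ler_ln ?posrE ?ltr0n ?ler_nat ?(leq_trans m0). Qed.

Lemma ln_prod_nat (r : seq nat) (P : pred nat) (F : nat -> nat) :
  (forall i, P i -> (0 < F i)%N) ->
  ln (\prod_(i <- r | P i) F i)%N%:R = \sum_(i <- r | P i) ln (F i)%:R :> R.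
Proof.
move=> F0; suff [] : (0 < \prod_(i <- r | P i) F i)%N /\
  ln (\prod_(i <- r | P i) F i)%N%:R = \sum_(i <- r | P i) ln (F i)%:R :> R by [].
elim/big_rec2 : _ => [|i y x Pi [x0 <-]]; first by rewrite ln1.
by rewrite muln_gt0 F0 // natrM lnM ?posrE ?ltr0n ?F0.
Qed.

(** * Sums over primes *)

(** A weak Stirling bound, with equality at [n = 1]. The step from [n] to [n + 1] reduces to
    [(n + 1) (ln (n + 1) - ln n) >= 1]. *)
Lemma ln_fact_le n : (0 < n)%N ->
  ln n`!%:R <= (n%:R + 1) * ln n%:R - n%:R + 1 :> R.
Proof.
case: n => // n _; elim: n => [|n IH]; first by rewrite ln1; lra.
rewrite factS natrM lnM ?posrE ?ltr0n ?fact_gt0 //.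
have n0 : 0 < n.+1%:R :> R by rewrite ltr0n.
have n1 : 0 < n.+2%:R :> R by rewrite ltr0n.
have := ln_ge1BV (n.+2%:R / n.+1%:R); rewrite divr_gt0 // => /(_ isT).
rewrite ln_div ?posrE // invf_div.
have E : n.+2%:R = n.+1%:R + 1 :> R by rewrite natr1.
have -> : 1 - n.+1%:R / n.+2%:R = n.+2%:R^-1 :> R.
  by apply: (mulIf (lt0r_neq0 n1)); rewrite mulrBl mul1r divfK ?mulVf ?gt_eqF // E addrAC subrr add0r.
move=> h; have {h} : 1 <= n.+2%:R * (ln n.+2%:R - ln n.+1%:R) :> R.
  by rewrite mulrC -ler_pdivrMr // div1r.
by move: IH; rewrite E; nra.
Qed.

Lemma sum_ln_primes_le n : (0 < n)%N ->
  \sum_(0 <= p < n.+1 | prime p) ln p%:R <= (n%:R - 1) * (2 * ln 2) :> R.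
Proof.
move=> n0; rewrite -(ln_prod_nat _ _ id); last by move=> i /prime_gt0.
have -> : (n%:R - 1) * (2 * ln 2) = ln (4 ^ n.-1)%N%:R :> R.
  rewrite natrX lnXn // -[4]/(2 * 2)%N%:R natrM lnM ?posrE // -[RHS]mulr_natl.
  by rewrite -subn1 natrB //; lra.
apply: ln_nat_le (primorial_leq n).
by rewrite prodn_cond_gt0 // => i /prime_gt0.
Qed.

Lemma sum_ln_prime_div_le n : (0 < n)%N ->
  \sum_(0 <= p < n.+1 | prime p) ln p%:R / p%:R <= ln n%:R + (2 * ln 2 - 1) :> R.
Proof.
move=> n0; set S := \sum_(_ <= _ < _ | _) _.
have leg : \sum_(0 <= p < n.+1 | prime p) (n %/ p)%:R * ln p%:R <= ln n`!%:R :> R.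
  have := ln_nat_le _ _ _ (prod_primes_pow_leq_fact n).
  rewrite prodn_cond_gt0 => [/(_ isT)|p /prime_gt0 p0]; last by rewrite expn_gt0 p0.
  rewrite ln_prod_nat; last by move=> p /prime_gt0 p0; rewrite expn_gt0 p0.
  apply: le_trans; apply: ler_sum => p /prime_gt0 p0.
  by rewrite natrX lnXn ?ltr0n // mulr_natl.
(* [n %/ p >= (n + 1) / p - 1] gives the factor [n + 1] that absorbs the error terms. *)
have low : (n%:R + 1) * S - \sum_(0 <= p < n.+1 | prime p) ln p%:R <=
    \sum_(0 <= p < n.+1 | prime p) (n %/ p)%:R * ln p%:R :> R.
  rewrite /S mulr_sumr -sumrB; apply: ler_sum => p /prime_gt0 p0.
  have -> : (n%:R + 1) * (ln p%:R / p%:R) - ln p%:R = ((n%:R + 1) / p%:R - 1) * ln p%:R :> R.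
    by rewrite mulrBl mul1r mulrAC mulrA.
  rewrite ler_wpM2r ?ln_nat_ge0 // lerBlDr ler_pdivrMr ?ltr0n //.
  by rewrite !natr1 -natrM ler_nat ltn_ceil.
have lf := ln_fact_le _ n0; have th := sum_ln_primes_le _ n0.
have l2 := ln2_ge; have n1 : 0 < n%:R + 1 :> R by rewrite natr1 ltr0n.
rewrite -(ler_pM2l n1).
(* The middle term is the sum of the bounds [lf] and [th]. Replacing [n - 1] by [n + 1] is allowed
   because [2 ln 2 >= 1]. *)
by apply: le_trans (_ : (n%:R + 1) * ln n%:R + (n%:R - 1) * (2 * ln 2 - 1) <= _); nra.
Qed.

Lemma ln_ratio_le (a b : R) : 0 < a -> 0 < b -> 1 - a / b <= ln b - ln a.
Proof.
move=> a0 b0; rewrite -ln_div ?posrE //.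
by have := ln_ge1BV (b / a); rewrite divr_gt0 // invf_div; apply.
Qed.

Lemma ln_nat_gt0 n : (1 < n)%N -> 0 < ln n%:R :> R.
Proof. by move=> n1; rewrite ln_gt0 // ltr1n. Qed.

(* Abel summation, with the contribution of the prime 2 computed exactly. *)
Lemma sum_prime_inv_le N : (3 <= N)%N ->
  \sum_(0 <= p < N.+1 | prime p) p%:R^-1 <= ln (ln N%:R) + 3 / 2 :> R.
Proof.
move=> N3; pose T n : R := \sum_(0 <= p < n.+1 | prime p) p%:R^-1.
pose S n : R := \sum_(0 <= p < n.+1 | prime p) ln p%:R / p%:R.
pose c : R := 2 * ln 2 - 1.
have l3 : 0 < ln 3 :> R by rewrite (ln_nat_gt0 3).
(* [K] is chosen to make [step] an equality at [n = 3]. *)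
pose K : R := 1 / 2 - ln 2 / (2 * ln 3) - ln (ln 3) + c / ln 3.
have step n : (3 <= n)%N -> T n - S n / ln n%:R <= ln (ln n%:R) - c / ln n%:R + K.
  elim: n => // n IH; rewrite leq_eqVlt => /orP[/eqP<-|n3].
    rewrite /T /S /K unlock /= -[3%:R]/(3 : R).
    suff -> : 2^-1 + (3^-1 + 0) - (ln 2 / 2 + (ln 3 / 3 + 0)) / ln 3 =
      1 / 2 - ln 2 / (2 * ln 3) :> R by lra.
    by field; rewrite gt_eqF.
  have {}IH := IH n3.
  have l0 : 0 < ln n%:R :> R by apply: ln_nat_gt0; lia.
  have l1 : 0 < ln n.+1%:R :> R by apply: ln_nat_gt0; lia.
  (* A new prime [n + 1] adds the same amount to both terms, so only the change of the denominator
     [ln n] counts. It is controlled by the bound on [S n] and by [ratio]. *)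
  have -> : T n.+1 - S n.+1 / ln n.+1%:R = T n - S n / ln n.+1%:R.
    have rec (F : nat -> R) : \sum_(0 <= p < n.+2 | prime p) F p =
        \sum_(0 <= p < n.+1 | prime p) F p + if prime n.+1 then F n.+1 else 0.
      by rewrite big_mkcond big_nat_recr //= -big_mkcond.
    rewrite /T /S !rec; case: ifP => _; last by rewrite !addr0.
    by rewrite mulrDl mulrAC divff ?gt_eqF // mul1r opprD addrACA subrr addr0.
  have Sn : S n <= ln n%:R + c by apply: sum_ln_prime_div_le; lia.
  have lle : ln n%:R <= ln n.+1%:R :> R.
    by apply: ln_nat_le => //; lia.
  have ratio := ln_ratio_le _ _ l0 l1.
  have h : S n * (1 / ln n%:R - 1 / ln n.+1%:R) <=
           (ln n%:R + c) * (1 / ln n%:R - 1 / ln n.+1%:R).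
    by rewrite ler_wpM2r // subr_ge0 !div1r lef_pV2.
  have E : (ln n%:R + c) * (1 / ln n%:R - 1 / ln n.+1%:R) =
      1 - ln n%:R / ln n.+1%:R + c / ln n%:R - c / ln n.+1%:R.
    by field; rewrite !gt_eqF.
  by move: h; rewrite E; lra.
have l0 : 0 < ln N%:R :> R by apply: ln_nat_gt0; lia.
have := step N N3; have : S N <= ln N%:R + c by apply: sum_ln_prime_div_le; lia.
rewrite -(ler_pM2r (x := (ln N%:R)^-1)) ?invr_gt0 // mulrDl divff ?gt_eqF // => h1 h2.
(* [K <= 1 / 2] amounts to [2 ^ 3 <= 3 ^ 2] and [1 - 1 / x <= ln x] at [x = ln 3]. *)
suff : K <= 1 / 2 by rewrite -/(T N); lra.
have := ln_ge1BV _ l3.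
have : ln 8 <= ln 9 :> R by rewrite ler_ln ?posrE //; lra.
have -> : ln 8 = 3 * ln 2 :> R.
  by rewrite -[8]/(2 ^ 3)%N%:R natrX lnXn // mulr_natl.
have -> : ln 9 = 2 * ln 3 :> R.
  by rewrite -[9]/(3 ^ 2)%N%:R natrX lnXn // mulr_natl.
move=> h3 h4.
have : (3 / 2 * ln 2 - 1) / ln 3 <= (ln 3 - 1) / ln 3 :> R.
  by rewrite ler_pM2r ?invr_gt0 //; lra.
have -> : (ln 3 - 1) / ln 3 = 1 - (ln 3)^-1 :> R by field; rewrite gt_eqF.
have -> : (3 / 2 * ln 2 - 1) / ln 3 = c / ln 3 - ln 2 / (2 * ln 3) :> R.
  by rewrite /c; field; rewrite gt_eqF.
by rewrite /K; lra.
Qed.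

End Mertens.

(** * The finite bound *)

Section FiniteBound.
Variable R : realType.

Lemma ln_diff_succ_ge (n : nat) : (0 < n)%N -> n.+1%:R^-1 <= ln n.+1%:R - ln n%:R :> R.
Proof.
move=> n0; have a0 : 0 < n%:R :> R by rewrite ltr0n.
have b0 : 0 < n.+1%:R :> R by rewrite ltr0n.
apply: le_trans (ln_ratio_le _ _ _ a0 b0).
rewrite -(ler_pM2r b0) mulrBl mul1r divfK ?mulVf ?gt_eqF //.
by rewrite -natrB // subSnn.
Qed.

Lemma harmonic_le (n : nat) : \sum_(1 <= i < n.+1) i%:R^-1 <= 1 + ln n%:R :> R.
Proof.
elim: n => [|[|n] IH]; first by rewrite big_nil ln0 // addr0.
  by rewrite big_nat1 ln1 invr1 addr0.
rewrite big_nat_recr //=; apply: le_trans (lerD IH (ln_diff_succ_ge n.+1 isT)) _.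
by rewrite -addrA subrKC.
Qed.

(** Among [k + 1] distinct positive integers one exceeds [k]; its reciprocal is at most
    [1 / (k + 1)], and induction handles the rest. *)
Lemma sum_inv_uniq_le (s : seq nat) : uniq s -> all (fun a => 0 < a)%N s ->
  \sum_(a <- s) a%:R^-1 <= \sum_(1 <= i < (size s).+1) i%:R^-1 :> R.
Proof.
have [n] := ubnP (size s); elim: n s => // n IH s sn us s0.
case E: (size s) => [|k]; first by rewrite (size0nil E) !big_nil.
have [m ms mk] : exists2 m, m \in s & (k < m)%N.
  apply/hasP; apply/negPn/negP; rewrite -all_predC => /allP h.
  suff /(uniq_leq_size us) : {subset s <= iota 1 k} by rewrite size_iota E ltnn.
  by move=> a as_; rewrite mem_iota; have := h _ as_; move/allP: s0 => /(_ _ as_) /=; lia.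
rewrite (perm_big _ (perm_to_rem ms)) big_cons big_nat_recr //= addrC lerD //.
  have := IH (rem m s); rewrite size_rem // E /=; apply.
  - by rewrite E in sn.
  - exact: rem_uniq.
  - by apply/allP => a /mem_rem; move/allP: s0; apply.
by rewrite lef_pV2 ?posrE ?ltr0n ?ler_nat //; lia.
Qed.

Lemma ler_sum_term (s : seq nat) (P : pred nat) (F : nat -> R) (i : nat) :
  (forall j, P j -> 0 <= F j) -> i \in s -> P i -> F i <= \sum_(j <- s | P j) F j.
Proof.
move=> F0 si Pi; rewrite (big_rem i) //= Pi lerDl.
by apply: sumr_ge0.
Qed.

Lemma sum_indicator_le (m n k : nat) (P : pred nat) (F : nat -> R) : 0 <= F k ->
  \sum_(m <= i < n | P i) (if i == k then F i else 0) <= F k.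
Proof.
move=> F0; have [kr|kr] := boolP (k \in index_iota m n); last first.
  rewrite big_seq_cond big1 // => i /andP[ir _].
  by rewrite ifN //; apply: contra kr => /eqP <-.
rewrite big_mkcond (bigD1_seq k) ?iota_uniq //= eqxx big1 ?addr0; first by case: ifP.
by move=> i /negPf ->; case: ifP.
Qed.

Section Half.
Variables (B G : pred nat) (N : nat).
Hypothesis N_gt0 : (0 < N)%N.
Hypothesis G_prime : forall p, G p -> prime p.
Hypothesis B_G : forall n, B n -> exists2 p, G p & (p %| n)%N.
Hypothesis B_indep : forall n p, G p -> B n -> B (p * n)%N -> False.

(** With floors, the sum over [B] is at most the sum over its complement. Removing the floors costs
    at most [N] in all on the side of [B], so after division by [N] the two sums differ by at most
    1, while together they are at most [1 + ln N]. *)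
Lemma sum_inv_half : \sum_(1 <= d < N.+1 | B d) d%:R^-1 <= 1 / 2 * ln N%:R + 1 :> R.
Proof.
have fl := sum_floor_half B G N G_prime B_G B_indep.
have NR : 0 < N%:R :> R by rewrite ltr0n.
have {}fl : \sum_(1 <= d < N.+1 | B d) (N %/ d)%:R <=
    \sum_(1 <= d < N.+1 | ~~ B d) (N %/ d)%:R :> R.
  rewrite -!natr_sum ler_nat.
  by move: fl; rewrite [in X in (_ <= X)%N -> _](bigID B) /= mul2n -addnn leq_add2l.
have up : \sum_(1 <= d < N.+1 | ~~ B d) (N %/ d)%:R <=
    N%:R * \sum_(1 <= d < N.+1 | ~~ B d) d%:R^-1 :> R.
  rewrite mulr_sumr big_nat_cond [leRHS]big_nat_cond; apply: ler_sum => d /andP[/andP[d0 _] _].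
  by rewrite ler_pdivlMr ?ltr0n // -natrM ler_nat leq_trunc_div.
have lo : N%:R * \sum_(1 <= d < N.+1 | B d) d%:R^-1 - N%:R <=
    \sum_(1 <= d < N.+1 | B d) (N %/ d)%:R :> R.
  rewrite mulr_sumr lerBlDr.
  apply: le_trans (_ : \sum_(1 <= d < N.+1 | B d) ((N %/ d)%:R + 1) <= _); last first.
    rewrite big_split /= lerD2l; apply: le_trans (_ : \sum_(1 <= d < N.+1) 1 <= _).
      by rewrite big_mkcond; apply: ler_sum => d _; case: ifP.
    by rewrite big_const_nat iter_addr_0 subn1.
  rewrite big_nat_cond [leRHS]big_nat_cond; apply: ler_sum => d /andP[/andP[d0 _] _].
  by rewrite ler_pdivrMr ?ltr0n // natr1 -natrM ler_nat ltnW // ltn_ceil.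
have := harmonic_le N; rewrite (bigID B) /=.
have : N%:R * (\sum_(1 <= d < N.+1 | B d) d%:R^-1 - 1 - \sum_(1 <= d < N.+1 | ~~ B d) d%:R^-1) <= 0 :> R.
  by rewrite !mulrBr mulr1; lra.
by rewrite pmulr_rle0 //; lra.
Qed.

End Half.

(** Each [n] in [C] is some [p * a] with [p] in [G] and [a], [p * a] in [A], so the sum is at most
    that of [1 / (p a)] over such pairs. For fixed [p] there are at most [k] values of [a], with
    reciprocal sum at most [1 + ln k]. *)
Lemma sum_deleted_le (A G C : pred nat) (N k : nat) :
  (forall n, C n -> (n <= N)%N -> (0 < n)%N ->
     exists p, [/\ G p, p %| n & A (n %/ p) && A (p * (n %/ p))]%N) ->
  (forall p, G p -> prime p /\ (count (fun a => A a && A (p * a)) (iota 1 N) <= k)%N) ->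
  \sum_(1 <= n < N.+1 | C n) n%:R^-1 <=
    (1 + ln k%:R) * \sum_(0 <= p < N.+1 | prime p) p%:R^-1 :> R.
Proof.
move=> CG Gk; pose D p a := (A a && A (p * a))%N.
apply: (@le_trans _ _ (\sum_(1 <= n < N.+1 | C n) \sum_(0 <= p < N.+1 | G p)
    \sum_(1 <= a < N.+1 | D p a) (if n == (p * a)%N then n%:R^-1 else 0))).
  rewrite big_nat_cond [leRHS]big_nat_cond; apply: ler_sum => n /andP[/andP[n0 nN] Cn].
  have [p [Gp pn Da]] := CG _ Cn nN n0.
  have p0 : (0 < p)%N by apply: dvdn_gt0 pn.
  have npn : (p * (n %/ p) = n)%N by rewrite mulnC divnK.
  apply: (@le_trans _ _ (\sum_(1 <= a < N.+1 | D p a) (if n == (p * a)%N then n%:R^-1 else 0))).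
    apply: (@le_trans _ _ (if n == (p * (n %/ p))%N then n%:R^-1 else 0)); first by rewrite npn eqxx.
    apply: (ler_sum_term _ _ (fun a => if n == (p * a)%N then n%:R^-1 else 0)) => //.
      by move=> a _; case: ifP.
    rewrite mem_index_iota divn_gt0 // (dvdn_leq n0) //= ltnS.
    by apply: leq_trans (leq_div _ _) _.
  apply: (ler_sum_term _ _ (fun p => \sum_(1 <= a < N.+1 | D p a) (if n == (p * a)%N then n%:R^-1 else 0))) => //.
    by move=> q _; apply: sumr_ge0 => a _; case: ifP.
  by rewrite mem_index_iota /= ltnS (leq_trans (dvdn_leq n0 pn)).
rewrite exchange_big /= mulr_sumr.
apply: (@le_trans _ _ (\sum_(0 <= p < N.+1 | G p) (1 + ln k%:R) / p%:R)); last first.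
  rewrite big_mkcond [leRHS]big_mkcond; apply: ler_sum => p _.
  case: ifP => [/Gk[-> //]|_]; case: ifP => // _.
  by rewrite divr_ge0 // addr_ge0 // ln_nat_ge0.
apply: ler_sum => p /Gk[pp ck]; rewrite exchange_big /=.
apply: (@le_trans _ _ (\sum_(1 <= a < N.+1 | D p a) p%:R^-1 * a%:R^-1)).
  apply: ler_sum => a _; rewrite -invfM -natrM.
  exact: (sum_indicator_le _ _ _ _ (fun n => n%:R^-1)).
rewrite -mulr_sumr mulrC ler_wpM2r // -big_filter.
apply: le_trans (sum_inv_uniq_le _ _ _) _; rewrite ?filter_uniq ?iota_uniq //.
  by apply/allP => a; rewrite mem_filter mem_iota => /andP[_ /andP[]].
have sk : (size [seq a <- index_iota 1 N.+1 | D p a] <= k)%N.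
  by rewrite size_filter /index_iota subn1.
apply: le_trans (harmonic_le k).
by rewrite [leRHS](@big_cat_nat _ _ _ (size [seq a <- index_iota 1 N.+1 | D p a]).+1) //= lerDl sumr_ge0.
Qed.

(** From [L ln 2 <= ln N] and [ln 2 >= 2 / 3] one gets [2 L <= 3 ln N]; then [ln 3 <= 5 / 4]. *)
Lemma ln_trunc_log2_le (N : nat) : (4 <= N)%N ->
  ln (2 * trunc_log 2 N)%N%:R <= ln (ln N%:R) + 5 / 4 :> R.
Proof.
move=> N4; set L := trunc_log 2 N.
have L0 : (0 < L)%N by rewrite trunc_log_gt0; lia.
have lN : 0 < ln N%:R :> R by apply: ln_nat_gt0; lia.
have l2 := ln2_ge R; have l3 := ln3_le R.
have : L%:R * ln 2 <= ln N%:R :> R.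
  rewrite mulr_natl -lnXn // -natrX; apply: ln_nat_le; rewrite ?expn_gt0 //.
  by apply: trunc_logP => //; lia.
move=> h; have h2 : (2 * L)%N%:R <= 3 * ln N%:R :> R.
  by rewrite natrM; have := ler_wpM2l (ler0n R L) l2; lra.
apply: (@le_trans _ _ (ln (3 * ln N%:R))).
  by rewrite ler_ln ?posrE ?mulr_gt0 // ltr0n; lia.
by rewrite lnM ?posrE //; lra.
Qed.

Lemma ln_ln_ge (N : nat) : (256 <= N)%N -> 3 / 2 <= ln (ln N%:R) :> R.
Proof.
move=> N256; have l2 := ln2_ge R.
have h : 16 / 3 <= ln N%:R :> R.
  have : ln (2 ^ 8)%N%:R <= ln N%:R :> R by apply: ln_nat_le.
  by rewrite natrX lnXn // -[leLHS]mulr_natl; lra.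
have : ln (16 / 3) <= ln (ln N%:R) :> R by rewrite ler_ln ?posrE; lra.
(* This gives [2 ln 2 + ln (4 / 3) >= 4 / 3 + 1 / 4 > 3 / 2]. *)
have -> : 16 / 3 = 2 * (2 * (4 / 3)) :> R by lra.
rewrite lnM ?[ln (2 * (4 / 3))]lnM ?posrE //; try lra.
by have := ln_ge1BV R (4 / 3); rewrite divr_gt0 // invf_div => /(_ isT); lra.
Qed.

Lemma sum_inv_admissible_le (A : pred nat) (N : nat) : (256 <= N)%N ->
  (forall n, A n -> (0 < n <= N)%N) ->
  (forall s t : seq nat, uniq s -> uniq t -> all A s -> all A t ->
    (\prod_(x <- s) x = \prod_(x <- t) x)%N -> size s = size t) ->
  \sum_(1 <= a < N.+1 | A a) a%:R^-1 <= 1 / 2 * ln N%:R + (ln (ln N%:R) + 2) ^+ 2 :> R.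
Proof.
move=> N256 AN Aadm; set k := (2 * trunc_log 2 N)%N.
pose G p := prime p && (count (fun a => A a && A (p * a)%N) (iota 1 N) < k)%N.
(* On [A], [hit] marks the elements [p * a] to be deleted: [p] good and [a] also in [A]. *)
pose hit n := has (fun p => G p && A (n %/ p)%N) (primes n).
rewrite (bigID hit) /= addrC.
have half : \sum_(1 <= d < N.+1 | A d && ~~ hit d) d%:R^-1 <= 1 / 2 * ln N%:R + 1 :> R.
  apply: (sum_inv_half _ G) => [|p|n|n p]; first by lia.
  - by case/andP.
  - move=> /andP[An _]; have /andP[n0 nN] := AN _ An.
    have [m /AN/andP[]//|p [pp pn pc]] := exists_good_prime A _ Aadm N n nN An.
    by exists p => //; rewrite /G pp.
  - move=> Gp /andP[An _] /andP[Apn /hasP[]].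
    have /andP[pp _] := Gp; have /andP[pn0 _] := AN _ Apn.
    exists p; first by rewrite mem_primes pp pn0 dvdn_mulr.
    by rewrite Gp mulKn // prime_gt0.
have del : \sum_(1 <= n < N.+1 | A n && hit n) n%:R^-1 <=
    (1 + ln k%:R) * \sum_(0 <= p < N.+1 | prime p) p%:R^-1 :> R.
  apply: (sum_deleted_le A G) => [n|p /andP[pp /ltnW]] //.
  move=> /andP[An /hasP[p pn /andP[Gp Anp]]] _ _; exists p.
  move: pn; rewrite mem_primes => /and3P[_ _ pn]; split=> //.
  by rewrite Anp mulnC divnK.
have N3 : (3 <= N)%N by lia.
have lk : ln k%:R <= ln (ln N%:R) + 5 / 4 :> R by apply: ln_trunc_log2_le; lia.
have lp := sum_prime_inv_le R N N3; have LL := ln_ln_ge N N256.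
have k0 := ln_nat_ge0 R k.
set P := \sum_(_ <= _ < _ | prime _) _ in del lp.
have P0 : 0 <= P by apply: sumr_ge0.
apply: le_trans (lerD half del) _; set y := ln (ln _) in lk lp LL *.
(* Together with the 1 from [half], the comparison with [(y + 2) ^ 2] is equivalent to [y >= 3 / 2],
   which is [LL]. *)
have : (1 + ln k%:R) * P <= (y + 9 / 4) * (y + 3 / 2) by rewrite ler_pM //; lra.
by rewrite expr2; lra.
Qed.

End FiniteBound.

(** * Densities *)

Lemma admissible_seq (A : set nat) (s t : seq nat) : admissible A ->
  uniq s -> uniq t -> {subset s <= A} -> {subset t <= A} ->
  (\prod_(x <- s) x = \prod_(x <- t) x)%N -> size s = size t.
Proof.
move=> [_ adm] us ut sA tA E.
have P (r : seq nat) : uniq r -> perm_eq [fset x in r]%fset r.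
  by move=> ur; apply: uniq_perm => // x; rewrite inE.
have := adm [fset x in s]%fset [fset x in t]%fset.
rewrite !(perm_big _ (P _ _)) // => H.
rewrite -(perm_size (P s us)) -(perm_size (P t ut)).
by apply: H => // x /=; rewrite inE; [move=> /sA|move=> /tA]; rewrite inE.
Qed.

Lemma bounded_set_finite (A : set nat) (N : nat) :
  A `<=` [set a | (1 <= a <= N)%N] -> finite_set A.
Proof.
move=> AN; apply: (@sub_finite_set _ _ `I_N.+1); last exact: finite_II.
by move=> a /AN /andP[].
Qed.

Lemma bounded_set_perm (A : set nat) (N : nat) :
  A `<=` [set a | (1 <= a <= N)%N] ->
  perm_eq (fset_set A) [seq a <- index_iota 1 N.+1 | a \in A].
Proof.
move=> AN; apply: uniq_perm; rewrite ?filter_uniq ?iota_uniq // => a.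
rewrite in_fset_set; last exact: bounded_set_finite AN.
rewrite mem_filter mem_index_iota; case aA : (a \in A) => //=.
by move: aA => /set_mem /AN.
Qed.

Section Density.
Variable R : realType.

Lemma fsbig_bounded_set (A : set nat) (N : nat) (F : nat -> R) :
  A `<=` [set a | (1 <= a <= N)%N] ->
  \sum_(a \in A) F a = \sum_(1 <= a < N.+1 | a \in A) F a.
Proof.
move=> AN; rewrite fsbig_finite /=; last exact: bounded_set_finite AN.
by rewrite (perm_big _ (bounded_set_perm _ _ AN)) big_filter.
Qed.

Lemma card_bounded_set (A : set nat) (N : nat) :
  A `<=` [set a | (1 <= a <= N)%N] ->
  #|` fset_set A|%:R = \sum_(1 <= a < N.+1 | a \in A) 1 :> R.
Proof.
move=> AN; rewrite (perm_size (bounded_set_perm _ _ AN)) -sum1_size natr_sum.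
by rewrite big_filter.
Qed.

Lemma sum_inv_admissible_set_le (A : set nat) (N : nat) : (256 <= N)%N -> admissible A ->
  \sum_(1 <= a < N.+1 | a \in A) a%:R^-1 <= 1 / 2 * ln N%:R + (ln (ln N%:R) + 2) ^+ 2 :> R.
Proof.
move=> N256 Aadm; pose B a := (a \in A) && (a <= N)%N.
have -> : \sum_(1 <= a < N.+1 | a \in A) a%:R^-1 = \sum_(1 <= a < N.+1 | B a) a%:R^-1 :> R.
  rewrite big_nat_cond [RHS]big_nat_cond; apply: eq_bigl => a.
  by rewrite /B ltnS; case: (a <= N)%N; rewrite ?andbF ?andbT.
apply: sum_inv_admissible_le => // [n /andP[nA ->]|s t us ut /allP sB /allP tB].
  by rewrite andbT; move: nA; rewrite inE => /(Aadm.1).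
by apply: (admissible_seq A) => // a; [move=> /sB /andP[]|move=> /tB /andP[]].
Qed.

(** With [s] the fourth root of [y], [ln y + 2 = 4 ln s + 2 <= 4 s], whose square is [16 sqrt y];
    and [sqrt y >= 16 / e]. *)
Lemma sqr_ln_le (e y : R) : 0 < e -> 1 <= y -> (16 / e) ^+ 2 <= y -> (ln y + 2) ^+ 2 <= e * y.
Proof.
move=> e0 y1 ye; have y0 : 0 <= y by lra.
pose r := Num.sqrt y; pose s := Num.sqrt r.
have r2 : r ^+ 2 = y by rewrite sqr_sqrtr.
have s2 : s ^+ 2 = r by rewrite sqr_sqrtr ?sqrtr_ge0.
have r0 : 0 <= r by apply: sqrtr_ge0.
have s0 : 0 <= s by apply: sqrtr_ge0.
have r1 : 1 <= r by rewrite -sqrtr1 ler_sqrt.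
have s1 : 1 <= s by rewrite -[leLHS]sqrtr1 ler_sqrt.
have re : 16 / e <= r.
  by rewrite -(ler_pXn2r (n := 2)) ?nnegrE ?r2 // divr_ge0 // ltW.
have er : 16 <= e * r by rewrite mulrC -ler_pdivrMr.
have l0 : 0 <= ln y by rewrite ln_ge0.
have -> : y = r * r by rewrite -r2 expr2.
have -> : ln (r * r) = 4 * ln s.
  by rewrite -expr2 -s2 -exprM lnXn ?mulr_natl //; lra.
have l1 : 0 <= ln s by rewrite ln_ge0.
have ls : ln s <= s - 1 by apply: ln_leB1; lra.
apply: (@le_trans _ _ (16 * r)); last by rewrite mulrA ler_wpM2r.
have -> : 16 * r = (4 * s) ^+ 2 by rewrite exprMn s2 -natrX.
by rewrite ler_pXn2r ?nnegrE //; lra.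
Qed.

Lemma log_sum_eventually_le (A : set nat) (e : R) : admissible A -> 0 < e ->
  exists2 M : R, 1 < M & forall X : R, M <= X ->
    \sum_(1 <= a < (Num.trunc X).+1 | a \in A) a%:R^-1 <= (1 / 2 + e) * ln X.
Proof.
move=> Aadm e0; pose Y := 1 + (16 / e) ^+ 2.
have Y1 : 1 <= Y by rewrite lerDl sqr_ge0.
(* The summand 256 makes the finite bound apply to [Num.trunc X]; [expR Y] makes [sqr_ln_le] apply
   to [ln X]. *)
exists (256 + expR Y) => [|X MX]; first by have := expR_gt0 Y; lra.
have eY := expR_gt0 Y; have X0 : 0 < X by lra.
have XY : Y <= ln X by rewrite -[leLHS]expRK ler_ln ?posrE //; lra.
have /andP[NX _] := truncn_itv (ltW X0).
have N256 : (256 <= Num.trunc X)%N by rewrite truncn_ge_nat ?ltW //; lra.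
have N0 : 0 < (Num.trunc X)%:R :> R by rewrite ltr0n; lia.
have lNX : ln (Num.trunc X)%:R <= ln X by rewrite ler_ln ?posrE.
have lN : 0 < ln (Num.trunc X)%:R :> R by apply: ln_nat_gt0; lia.
have llNX : ln (ln (Num.trunc X)%:R) <= ln (ln X).
  by rewrite ler_ln ?posrE //; lra.
have ll := ln_ln_ge R _ N256.
apply: le_trans (sum_inv_admissible_set_le _ _ N256 Aadm) _.
have : (ln (ln X) + 2) ^+ 2 <= e * ln X.
  by apply: sqr_ln_le => //; [lra|apply: le_trans XY; rewrite lerDr].
have : (ln (ln (Num.trunc X)%:R) + 2) ^+ 2 <= (ln (ln X) + 2) ^+ 2.
  by rewrite ler_pXn2r ?nnegrE //; lra.
by rewrite mulrDl; lra.
Qed.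

Lemma bounded_setI (A : set nat) (X : R) : admissible A -> 0 <= X ->
  A `&` [set a | (a%:R : R) <= X] `<=` [set a | (1 <= a <= Num.trunc X)%N].
Proof. by move=> [A0 _] X0 a [/A0 /= -> /=]; rewrite truncn_ge_nat. Qed.

Lemma mem_bounded_setI (A : set nat) (X : R) (a : nat) : 0 <= X ->
  (a <= Num.trunc X)%N -> (a \in A `&` [set a | (a%:R : R) <= X]) = (a \in A).
Proof.
move=> X0 aX; rewrite in_setI; case: (a \in A) => //=.
by apply: mem_set; rewrite /= -truncn_ge_nat.
Qed.

Lemma log_averageE (A : set nat) (X : R) : admissible A -> 0 <= X ->
  log_average A X = (ln X)^-1 * \sum_(1 <= a < (Num.trunc X).+1 | a \in A) a%:R^-1.
Proof.
move=> Aadm X0; rewrite /log_average (fsbig_bounded_set _ (Num.trunc X)); last exact: bounded_setI.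
congr (_ * _); rewrite big_nat_cond [RHS]big_nat_cond; apply: eq_bigl => a.
by case aX: (1 <= a < _)%N => //=; move/andP: aX => [_ aX]; rewrite mem_bounded_setI.
Qed.

Lemma upper_log_density_le (A : set nat) : admissible A ->
  (upper_log_density R A <= (1 / 2)%:E)%E.
Proof.
move=> Aadm; apply/lee_addgt0Pr => e e0.
have [M M1 HM] := log_sum_eventually_le A e Aadm e0.
rewrite /upper_log_density limf_esupE; apply: ge_ereal_inf.
exists (ereal_sup [set (log_average A X)%:E | X in [set X | M <= X]]).
  by exists [set X | M <= X] => //; apply: nbhs_pinfty_ge; exact: num_real.
apply: ge_ereal_sup => _ [X /= MX <-]; rewrite -EFinD lee_fin.
have X0 : 0 <= X by lra.
rewrite log_averageE // mulrC ler_pdivrMr ?ln_gt0 ?HM //; lra.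
Qed.

(** Abel summation: [D], the logarithmic sum minus [c n / n], grows from [N] to [N + 1] by
    [c N / (N (N + 1)) >= d / (N + 1)]. This dominates [d (ln (N + 2) - ln (N + 1))], whence the
    logarithms shifted by one in [H]. *)
Lemma log_sum_ge_of_density (A : set nat) (n0 : nat) (d : R) : (0 < n0)%N ->
  (forall n, (n0 <= n)%N -> d * n%:R <= \sum_(1 <= a < n.+1 | a \in A) 1) ->
  exists K, forall N, (n0 <= N)%N -> 0 <= d ->
    d * ln N%:R - K <= \sum_(1 <= a < N.+1 | a \in A) a%:R^-1.
Proof.
move=> n0_gt0 Hd; pose c n : R := \sum_(1 <= a < n.+1 | a \in A) 1.
pose D n : R := \sum_(1 <= a < n.+1 | a \in A) a%:R^-1 - c n / n%:R.
exists (d * ln n0.+1%:R - D n0) => N nN d0.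
suff H : D n0 + d * (ln N.+1%:R - ln n0.+1%:R) <= D N.
  have c0 : 0 <= c N / N%:R by rewrite divr_ge0 // sumr_ge0.
  have : d * ln N%:R <= d * ln N.+1%:R.
    by rewrite ler_wpM2l // ln_nat_le //; lia.
  by move: H; rewrite mulrBr /D; lra.
elim: N nN => [|N IH]; first by lia.
rewrite leq_eqVlt => /orP[/eqP<-|nN]; first by rewrite subrr mulr0 addr0.
have {}IH := IH nN; have N0 : (0 < N)%N by lia.
have a0 : 0 < N%:R :> R by rewrite ltr0n.
have b0 : 0 < N.+1%:R :> R by rewrite ltr0n.
have rec (F : nat -> R) : \sum_(1 <= a < N.+2 | a \in A) F a =
    \sum_(1 <= a < N.+1 | a \in A) F a + if N.+1 \in A then F N.+1 else 0.
  by rewrite big_mkcond big_nat_recr //= -big_mkcond.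
have DE : D N.+1 - D N = c N / N%:R / N.+1%:R.
  have -> : D N.+1 - D N = c N / N%:R - c N / N.+1%:R.
    have alg (s t g x y : R) : s + g * y - (t + g) * y - (s - t * x) = t * x - t * y by ring.
    rewrite /D /c !rec; case: ifP => _; first by rewrite -[X in _ + X - _ - _]mul1r alg.
    by rewrite -[X in _ + X - _ - _](mul0r N.+1%:R^-1) alg.
  apply: (mulIf (lt0r_neq0 b0)); rewrite mulrBl !divfK ?gt_eqF // -natr1 mulrDr mulr1.
  by rewrite divfK ?gt_eqF // addrAC subrr add0r.
have lg : ln N.+2%:R - ln N.+1%:R <= N.+1%:R^-1 :> R.
  rewrite -ln_div ?posrE //; apply: le_trans (ln_leB1 _ _ _) _; first by rewrite divr_gt0.
  rewrite -(ler_pM2r b0) mulrBl mulVf ?divfK ?gt_eqF // mul1r.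
  by rewrite -natrB // subSnn.
have h : d / N.+1%:R <= c N / N%:R / N.+1%:R.
  by rewrite ler_pM2r ?invr_gt0 // ler_pdivlMr // Hd.
have h2 : d * (ln N.+2%:R - ln N.+1%:R) <= d / N.+1%:R by rewrite ler_wpM2l.
rewrite -[D N.+1](subrKC (D N)) DE (le_trans _ (lerD IH (le_trans h2 h))) //.
have alg (s t x y z : R) : s + t * (x - z) = s + t * (y - z) + t * (x - y) by ring.
by rewrite (alg _ _ _ (ln N.+1%:R)).
Qed.

Lemma natural_density_le (A : set nat) (d : R) : admissible A ->
  has_natural_density A d -> d <= 1 / 2.
Proof.
(* Then [1 / 2 + 2 e < d]: the density forces a logarithmic sum of at least
   [(1 / 2 + 2 e) ln N - K], against the upper bound [(1 / 2 + e) ln N]. *)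
move=> Aadm Hd; rewrite leNgt; apply/negP => d2; pose e := (d - 1 / 2) / 3.
have e0 : 0 < e by rewrite /e; lra.
have : \forall X \near +oo, 1 / 2 + 2 * e <
    #|` fset_set (A `&` [set a | 1 <= (a%:R : R) <= X])|%:R / X.
  by apply: (cvgr_gt d) => //; rewrite /e; lra.
case=> M1 [_ HM1]; have [M M_gt1 HM] := log_sum_eventually_le A e Aadm e0.
pose n0 := (Num.trunc (`|M1| + M)).+1.
have n0M : `|M1| + M < n0%:R by have /andP[] := @truncn_itv _ (`|M1| + M) ltac:(by rewrite addr_ge0 //; lra).
have n0P : (0 < n0)%N by [].
have M1M := ler_norm M1; have M1n := normr_ge0 M1.
have [n nn0|K HK] := log_sum_ge_of_density A n0 (1 / 2 + 2 * e) n0P.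
  have nR : n0%:R <= n%:R :> R by rewrite ler_nat.
  have n_gt0 : 0 < n%:R :> R by lra.
  have nM1 : M1 < n%:R by lra.
  have := HM1 _ nM1; rewrite ltr_pdivlMr //= => /ltW /le_trans; apply.
  rewrite (card_bounded_set _ n); last first.
    by move=> a [_ /=]; rewrite ler1n ler_nat.
  set B := A `&` _.
  suff -> : \sum_(1 <= a < n.+1 | a \in B) 1 = \sum_(1 <= a < n.+1 | a \in A) 1 :> R by [].
  rewrite big_nat_cond [RHS]big_nat_cond; apply: eq_bigl => a; case an: (1 <= a < n.+1)%N => //=; move/andP: an => [a1 an].
  rewrite in_setI; case: (a \in A) => //=.
  by apply: mem_set; rewrite /= ler1n ler_nat a1.
(* For [N > X] one has [e ln N >= |K| + 1], more than the [K] that the two bounds leave. *)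
pose X := expR ((`|K| + 1) / e) + n0%:R.
have X0 : 0 <= X by rewrite addr_ge0 // expR_ge0.
pose N := (Num.trunc X).+1; have /andP[_ XN] := truncn_itv X0; rewrite -/N in XN.
have eK := expR_gt0 ((`|K| + 1) / e).
have n0N : (n0 <= N)%N by rewrite -(ler_nat R); rewrite /X in XN; lra.
have lN : (`|K| + 1) / e <= ln N%:R.
  by rewrite -[leLHS]expRK ler_ln ?posrE //; rewrite /X in XN; lra.
have NR : n0%:R <= N%:R :> R by rewrite ler_nat.
have MN : M <= N%:R by lra.
have := HM _ MN; rewrite natrK => up.
have lo := HK N n0N ltac:(lra).
rewrite ler_pdivrMr // in lN; have Kn := ler_norm K.
by rewrite !mulrDl in lo up; lra.
Qed.

End Density.

Theorem theorem1 (R : realType) :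
  (forall (N : nat) (A : set nat), (286 <= N)%N -> admissible A ->
     A `<=` [set a | (1 <= a <= N)%N] ->
     \sum_(a \in A) (a%:R : R)^-1
       <= 1 / 2 * ln N%:R + (ln (ln N%:R) + 2) ^+ 2) /\
  (forall A : set nat, admissible A ->
     (upper_log_density R A <= (1 / 2)%:E)%E /\
     (forall d : R, has_natural_density A d -> d <= 1 / 2)).
Proof.
split=> [N A N286 Aadm AN|A Aadm].
  rewrite (fsbig_bounded_set _ _ N) //; apply: sum_inv_admissible_set_le => //.
  by lia.
by split=> [|d]; [exact: upper_log_density_le|exact: natural_density_le].
Qed.
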